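(* Let $S$ be a closed topological surface with a cellular decomposition $\Sigma=(V,E,F)$ and let $\Phi\in(0,\frac{\pi}{2})^{|E|}$ be a weight. Let $\hat L=(\hat L_1,\dots,\hat L_{|F|})^T\in\mathbb{R}^{|F|}$ be a prescribed total geodesic curvature on the face set $F$. Then there exists a spherical conical metric on $S$ with total geodesic curvature $\hat L$ if and only if $\hat L\in\mathcal{L}$, where $\mathcal{L}=\mathcal{L}_1\cup\bar\partial\mathcal{L}$, $$\mathcal{L}_1=\Big\{(L_1,\dots,L_{|F|})^T\in\mathbb{R}^{|F|}_{>0} : \sum_{f\in F'}L_f<2\sum_{e\in E_{F'}}\Phi(e)\ \text{ for every nonempty } F'\subset F\Big\},$$ $$\bar\partial\mathcal{L}=\Big(\bigcup_{1\le m\le |F|-1,\ 1\le i_1<\cdots<i_m\le |F|}\mathcal{L}_{i_1\cdots i_m}\Big)\cup\{0\},$$ and $\mathcal{L}_{i_1\cdots i_m}$ is the set of all $(L_1,\dots,L_{|F|})^T\in\mathbb{R}^{|F|}$ such that $L_{i_j}>0$ for $1\le j\le m$, $L_i=0$ for $i\notin F_{i_1\cdots i_m}:=\{i_1,\dots,i_m\}$, and $\sum_{f\in F'}L_f<2\sum_{e\in E_{F'}}\Phi(e)$ for every nonempty $F'\subset F_{i_1\cdots i_m}$. Moreover, the spherical conical metric is unique up to isometry if it exists.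
   Context: Cellular decomposition: $V,E,F$ are the finite sets of 0-, 1- and 2-cells of $\Sigma$, and $F=\{1,\dots,|F|\}$. For $f\in F$, $E_f$ is the set of 1-cells contained in $\partial f$ (every face has at least one such 1-cell). For $F'\subset F$, $E_{F'}=\{e\in E : \exists f\in F',\ e\in E_f\}$. The 2-cells on the two sides of $e\in E$ are denoted $f_1(e),f_2(e)$ (possibly equal). Bigons: for $r_1,r_2\in(0,\frac{\pi}{2}]$ and $\phi\in(0,\frac{\pi}{2})$, there are round disks $D_1,D_2\subset\mathbb{S}^2$ (unit sphere) of radii $r_1,r_2$, unique up to isometry, such that $D_1\cap D_2$ is a bigon with interior angle $\phi$; the distance $r_3$ between the centers satisfies $\cos r_3=\cos r_1\cos r_2-\sin r_1\sin r_2\cos\phi$. The two sides of the bigon are arcs of $\partial D_1$ and $\partial D_2$, of lengths $\ell_1,\ell_2$. The geodesic curvature of $\partial D_i$ is $k_i=\cot r_i\ge 0$, and the total geodesic curvature of the side on $\partial D_i$ is $\ell_ik_i$. Metrics: given radii $\mathbf r=(r_1,\dots,r_{|F|})\in(0,\frac{\pi}{2}]^{|F|}$, choose an auxiliary point in each 2-cell and join it to the vertices on the boundary of that 2-cell; for $e\in E$ let $Q(e)$ be the quadrilateral whose vertices are the end points of $e$ and the auxiliary points of the two 2-cells adjacent to $e$. Give $Q(e)$ the spherical metric of the quadrilateral whose vertices are the centers of two disks in $\mathbb{S}^2$ of radii $r_{f_1(e)},r_{f_2(e)}$ with intersection angle $\Phi(e)$ (interior angle of the bigon $B_e$ formed by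 their intersection) and the two intersection points of their boundary circles. Gluing the $Q(e)$ along their sides gives a spherical conical metric on $S$ together with a circle pattern (one disk of radius $r_f$ for each $f\in F$) realizing $\Phi$. Put $k_f=\cot r_f$; the metric with its circle pattern is identified with the vector $k=(k_1,\dots,k_{|F|})^T\in\mathbb{R}_{\ge0}^{|F|}$, which determines it up to isometry, so that ''unique up to isometry'' means that $k$ is unique. ''Spherical conical metric'' refers to any metric so obtained, i.e. to any $k\in\mathbb{R}^{|F|}_{\ge0}$. Total geodesic curvature: for $e\in E_f$, $L_{f,e}=\ell_{f,e}k_f$, where $\ell_{f,e}$ is the length of the side of $B_e$ lying on the boundary of the disk of $f$. The total geodesic curvature of $f$ is $L_f=\sum_{e\in E_f}L_{f,e}$ (if $f$ lies on both sides of $e$, both sides of $B_e$ are counted). The metric has total geodesic curvature $\hat L$ if $L_f=\hat L_f$ for all $f\in F$. *)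

(* Defs.v *)
From HB Require Import structures.
From mathcomp Require Import all_boot all_order all_algebra.
From mathcomp Require Import all_classical all_reals all_analysis.
From mathcomp Require Import ring lra.

Set Implicit Arguments.
Unset Strict Implicit.
Unset Printing Implicit Defensive.

Import Order.TTheory GRing.Theory Num.Theory.
Import numFieldNormedType.Exports.
Local Open Scope classical_set_scope.
Local Open Scope ring_scope.

Section Surface.
Variable R : realType.

Definition homeomorphism_on (T U : topologicalType) (A : set T) (B : set U)
    (f : T -> U) :=
  [/\ set_bij A B f, {within A, continuous f} &
      forall O, open O -> exists2 O', open O' & f @` (A `&` O) = B `&` O'].

Definition sqnorm d (x : 'rV[R]_d) : R := \sum_i x 0 i ^+ 2.

Definition plane_chart (S : topologicalType) (U : set S)
    (phi : S -> 'rV[R]_2) :=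
  open U /\ homeomorphism_on U [set: 'rV[R]_2] phi.

(* Second countability is automatic; S is not required to be connected nor
   orientable. *)
Definition closed_surface (S : topologicalType) :=
  [/\ compact [set: S], hausdorff_space S &
      forall x : S, exists U phi, plane_chart U phi /\ U x].

(* g is the characteristic map of the open d-cell C, attached along skel *)
Definition characteristic_map (S : topologicalType) d (g : 'rV[R]_d -> S)
    (C skel : set S) :=
  [/\ {within [set x | sqnorm x <= 1], continuous g},
      homeomorphism_on [set x | sqnorm x < 1] C g &
      g @` [set x | sqnorm x = 1] `<=` skel].

(* The two sides of the 1-cell e near its point x are the 2-cells f1 and f2. *)
Definition local_sides (S : topologicalType) (x : S) (e f1 f2 : set S) :=
  exists U phi, [/\ plane_chart U phi, U x &
    forall y, U y -> [/\ e y <-> phi y 0 1 = 0,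
                         0 < phi y 0 1 -> f1 y &
                         phi y 0 1 < 0 -> f2 y]].

Definition cells (S : topologicalType) (V E : finType) n
    (vertex : V -> S) (edge : E -> set S) (face : 'I_n -> set S)
    (c : V + E + 'I_n) : set S :=
  match c with
  | inl (inl v) => [set vertex v]
  | inl (inr e) => edge e
  | inr f => face f
  end.

Definition cell_boundary (S : topologicalType) (f : set S) : set S :=
  closure f `\` f.

Record cellular_decomposition (S : topologicalType) (V E : finType) (n : nat) :=
  CellularDecomposition {
    vertex : V -> S;
    edge : E -> set S;
    face : 'I_n -> set S;
    cells_disjoint : trivIset setT (cells vertex edge face);
    cells_cover : \bigcup_c cells vertex edge face c = setT;
    edge_char : forall e, exists g : 'rV[R]_1 -> S,
      characteristic_map g (edge e) (range vertex);
    face_char : forall f, exists g : 'rV[R]_2 -> S,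
      characteristic_map g (face f) (range vertex `|` \bigcup_e edge e);
    face_has_edge : forall f, exists e, edge e `<=` cell_boundary (face f);
    side1 : E -> 'I_n;
    side2 : E -> 'I_n;
    sidesP : forall e x, edge e x ->
      local_sides x (edge e) (face (side1 e)) (face (side2 e))
  }.

Section FaceEdges.
Variables (S : topologicalType) (V E : finType) (n : nat).
Variable Sigma : cellular_decomposition S V E n.

Definition face_edges (f : 'I_n) : {set E} :=
  [set e | `[< edge Sigma e `<=` cell_boundary (face Sigma f) >]]%SET.

Definition faces_edges (F' : {set 'I_n}) : {set E} :=
  (\bigcup_(f in F') face_edges f)%SET.

End FaceEdges.
End Surface.

Section Bigon.
Variable R : realType.

Definition vec3 (a b c : R) : 'rV[R]_3 := \row_i [:: a; b; c]`_i.

Definition dot (x y : 'rV[R]_3) : R := \sum_i x 0 i * y 0 i.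

Definition unit_sphere : set 'rV[R]_3 := [set x | dot x x = 1].

Definition disk (c : 'rV[R]_3) (r : R) : set 'rV[R]_3 :=
  [set x | unit_sphere x /\ acos (dot c x) <= r].

(* The intersection point of the two boundary circles is put at the north pole;
   the angle there between the directions to the two centers is pi - phi, so
   that the interior angle of the bigon is phi (see bigon_angle). *)
Definition pole : 'rV[R]_3 := vec3 0 0 1.

Definition center1 (r1 : R) : 'rV[R]_3 := vec3 (sin r1) 0 (cos r1).

Definition center2 (r2 phi : R) : 'rV[R]_3 :=
  vec3 (sin r2 * cos (pi - phi)) (sin r2 * sin (pi - phi)) (cos r2).

(* The boundary circle of the first disk: the second and third vectors
   complete center1 r1 to an orthonormal basis. *)
Definition circle1 (r1 t : R) : 'rV[R]_3 :=
  cos r1 *: center1 r1 +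
  sin r1 *: (cos t *: vec3 (- cos r1) 0 (sin r1) + sin t *: vec3 0 1 0).

(* The side of the bigon lying on the boundary of the disk of radius r1, which
   is a circle of Euclidean radius sin r1; the side on the boundary of the
   disk of radius r2 is obtained by exchanging r1 and r2. *)
Definition side_length (r1 r2 phi : R) : R :=
  sin r1 * fine (lebesgue_measure
    [set t : R | 0 <= t < 2 * pi /\ disk (center2 r2 phi) r2 (circle1 r1 t)]).

(* Angle at p of the intersection of two disks with centers c1 and c2 whose
   boundaries pass through p: near p it is the set of directions having
   nonnegative product with both n1 and n2. *)
Definition interior_angle (p c1 c2 : 'rV[R]_3) : R :=
  let n1 := c1 - dot p c1 *: p in
  let n2 := c2 - dot p c2 *: p in
  pi - acos (dot n1 n2 / (Num.sqrt (dot n1 n1) * Num.sqrt (dot n2 n2))).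

Lemma dot_vec3 (a b c a' b' c' : R) :
  dot (vec3 a b c) (vec3 a' b' c') = a * a' + b * b' + c * c'.
Proof. by rewrite /dot !big_ord_recl big_ord0 !mxE /= addr0 addrA. Qed.

Lemma addv3 (a b c a' b' c' : R) :
  vec3 a b c + vec3 a' b' c' = vec3 (a + a') (b + b') (c + c').
Proof. by apply/rowP => -[[|[|[|//]]] i]; rewrite !mxE. Qed.

Lemma scalev3 (k a b c : R) : k *: vec3 a b c = vec3 (k * a) (k * b) (k * c).
Proof. by apply/rowP => -[[|[|[|//]]] i]; rewrite !mxE. Qed.

Lemma oppv3 (a b c : R) : - vec3 a b c = vec3 (- a) (- b) (- c).
Proof. by apply/rowP => -[[|[|[|//]]] i]; rewrite !mxE. Qed.

Lemma circle1_center (r1 t : R) : dot (center1 r1) (circle1 r1 t) = cos r1.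
Proof.
rewrite /circle1 /center1 !(scalev3, addv3) dot_vec3.
transitivity (cos r1 * (cos r1 ^+ 2 + sin r1 ^+ 2)); first by ring.
by rewrite cos2Dsin2 mulr1.
Qed.

Lemma circle1_unit (r1 t : R) : unit_sphere (circle1 r1 t).
Proof.
rewrite /unit_sphere /= /circle1 /center1 !(scalev3, addv3) dot_vec3.
have h1 := cos2Dsin2 r1; have h2 := cos2Dsin2 t.
transitivity ((cos r1 ^+ 2 + sin r1 ^+ 2 * cos t ^+ 2)
   * (cos r1 ^+ 2 + sin r1 ^+ 2) + sin r1 ^+ 2 * sin t ^+ 2); first by ring.
by rewrite h1 mulr1 -addrA -mulrDr h2 mulr1.
Qed.

Lemma center_dist (r1 r2 phi : R) : dot (center1 r1) (center2 r2 phi) =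
  cos r1 * cos r2 - sin r1 * sin r2 * cos phi.
Proof. by rewrite dot_vec3 cosB cospi sinpi; ring. Qed.

Lemma bigon_angle (r1 r2 phi : R) :
  0 < r1 <= pi / 2 -> 0 < r2 <= pi / 2 -> 0 < phi < pi / 2 ->
  interior_angle pole (center1 r1) (center2 r2 phi) = phi.
Proof.
move=> h1 h2 h3; have pi0 := pi_gt0 R.
have s1 : 0 < sin r1 by apply: sin_gt0_pi; lra.
have s2 : 0 < sin r2 by apply: sin_gt0_pi; lra.
rewrite /interior_angle /pole /center1 /center2 !dot_vec3.
set a := pi - phi; rewrite !(scalev3, oppv3, addv3) !dot_vec3.
set x := (X in Num.sqrt X * _); set y := (X in _ * Num.sqrt X).
have -> : x = sin r1 ^+ 2 by rewrite /x; ring.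
have -> : y = sin r2 ^+ 2.
  rewrite -[RHS]mulr1 -(cos2Dsin2 a) /y; ring.
rewrite !sqrtr_sqr !gtr0_norm //.
rewrite [X in acos X](_ : _ = cos a); last by field; rewrite !gt_eqF.
by rewrite cosK /a ?in_itv /=; lra.
Qed.

End Bigon.

Section Metric.
Variable R : realType.

Definition cot (x : R) : R := cos x / sin x.

(* the inverse of cot : ]0, pi / 2] -> [0, +oo[ *)
Definition radius (k : R) : R := pi / 2 - atan k.

Lemma radius_itv (k : R) : 0 <= k -> 0 < radius k <= pi / 2.
Proof.
move=> k0; have := atan_ltpi2 k; rewrite /radius => h.
have : 0 <= atan k by rewrite -(@atan0 R) le_atan.
lra.
Qed.

Lemma cot_radius (k : R) : cot (radius k) = k.
Proof.
rewrite /cot /radius cosB sinB cos_pihalf sin_pihalf !mul0r !mul1r subr0 add0r.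
exact: atanK.
Qed.

Variables (S : topologicalType) (V E : finType) (n : nat).
Variable Sigma : cellular_decomposition R S V E n.
Variable Phi : E -> R.

(* The spherical conical metric with its circle pattern is encoded by the
   vector of the geodesic curvatures k_f = cot r_f of its disks. *)
Definition conical_metric (k : 'cV[R]_n) := forall f, 0 <= k f 0.

(* L_{f,e}: when f lies on both sides of e, both sides of the bigon count. *)
Definition edge_curvature (k : 'cV[R]_n) (f : 'I_n) (e : E) : R :=
  let len g := side_length (radius (k f 0)) (radius (k g 0)) (Phi e) in
  (if side1 Sigma e == f then len (side2 Sigma e) * k f 0 else 0) +
  (if side2 Sigma e == f then len (side1 Sigma e) * k f 0 else 0).

Definition total_curvature (k : 'cV[R]_n) : 'cV[R]_n :=
  \col_f \sum_(e in face_edges Sigma f) edge_curvature k f e.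

Definition subset_bound (L : 'cV[R]_n) (F' : {set 'I_n}) :=
  \sum_(f in F') L f 0 < 2 * \sum_(e in faces_edges Sigma F') Phi e.

Definition calL1 : set 'cV[R]_n :=
  [set L : 'cV[R]_n | (forall f, 0 < L f 0) /\
           forall F' : {set 'I_n}, F' != finset.set0 -> subset_bound L F'].

Definition calL_face (I : {set 'I_n}) : set 'cV[R]_n :=
  [set L : 'cV[R]_n | [/\ forall i, i \in I -> 0 < L i 0,
               forall i, i \notin I -> L i 0 = 0 &
               forall F' : {set 'I_n}, F' != finset.set0 -> F' \subset I ->
                 subset_bound L F']].

Definition calL_boundary : set 'cV[R]_n :=
  (\bigcup_(I in [set I : {set 'I_n} | (1 <= #|I| <= n.-1)%N]) calL_face I)
  `|` [set 0].

Definition calL : set 'cV[R]_n := calL1 `|` calL_boundary.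

End Metric.

(* Main.v *)
Require Import Defs.
From mathcomp Require Import all_boot all_order all_algebra.
From mathcomp Require Import all_classical all_reals all_analysis.
From mathcomp Require Import ring lra.
Import Order.TTheory GRing.Theory Num.Theory.
Import numFieldNormedType.Exports.
Local Open Scope classical_set_scope.
Local Open Scope ring_scope.

Set Implicit Arguments.
Unset Strict Implicit.
Unset Printing Implicit Defensive.

(** The surface enters the problem only through the two faces beside each
    edge: the edges on the boundary of a face f are those with f on a side
    ([in_face_edges]). What remains is a system of finitely many equations
    whose terms are the curvatures T(x, y) of the side, on the disk of
    curvature x, of a bigon of angle phi between disks of curvatures x and y.
    Elementary trigonometry gives a closed formula for T ([side_lengthM]), and
    the whole proof rests on three properties of it:
    - T(x, y) is nonincreasing in y;
    - B(x, y) = T(x, y) + T(y, x) is increasing in x, the derivative being a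
      positive multiple of theta - sin theta cos theta, where theta is half
      the angle subtended by the side at the center of its disk
      ([is_derive_bigon_curvature]; by Gauss-Bonnet, B is 2 phi minus the area
      of the bigon);
    - B is bounded by 2 phi, and both B(x, x) and T(x, y) with y fixed tend to
      2 phi as x goes to infinity.

    Uniqueness ([face_curvature_inj]) is a maximum principle. Given two
    solutions k and k', sum the equations over the faces with k' < k. An edge
    with both sides in this set contributes B, an edge with one side contributes
    T, whose first argument is larger for k and whose second is smaller; so each
    contribution is larger for k, and the two sums cannot agree. The same
    summation, with B < 2 phi, proves that the inequalities defining the set of
    admissible curvatures are necessary ([sum_face_curvature_lt]).

    Existence ([face_curvature_onto]) is Perron's method. Call k a subsolution
    when no face has more curvature than prescribed; 0 is one. As the curvature
    of f decreases when the other coordinates grow, the coordinatewise supremum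
    of all subsolutions is again a subsolution, and if it missed the prescribed
    value at f then its f-coordinate could be increased a little further. The
    supremum is finite because of the prescribed inequalities: along
    subsolutions that go to infinity exactly on P, the sum of the curvatures
    over P would approach twice the sum of the angles of the edges around P,
    which exceeds the prescribed sum ([subsolution_gap],
    [subsolution_bounded]).

    The faces with prescribed curvature 0 need no separate treatment: T(x, y)
    vanishes exactly when x = 0, so such a face has k = 0 in every
    subsolution, and [calLP] rewrites the union over faces of the boundary as a
    single condition on the support of the prescribed vector. *)

(** * The curvature of a side of a bigon *)

Section SideCurvature.
Variable R : realType.
Implicit Types (x y q t phi : R).

Lemma is_derive_gt0_lt (f df : R -> R) a b :
  (forall x, is_derive x 1 f (df x)) ->
  (forall x, x \in `]a, b[ -> 0 < df x) -> a < b -> f a < f b.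
Proof.
move=> fdf df0 ab; apply: (@gtr0_derive1_lt_cc _ f a b) => //.
- by move=> x xab; rewrite derive1E; case: (fdf x) => _ ->; apply: df0.
- apply: continuous_subspaceT => x; apply: differentiable_continuous.
  by apply/derivable1_diffP; case: (fdf x).
- by rewrite in_itv /= lexx ltW.
- by rewrite in_itv /= lexx ltW.
Qed.

Lemma sinM_cos_lt t : 0 < t < pi -> sin t * cos t < t.
Proof.
move=> /andP[t0 tpi]; rewrite -subr_gt0.
(* The derivative of t - sin t cos t is 2 (sin t)^2. *)
pose df (x : R) := 1 - (sin x * - sin x + cos x * cos x).
have := @is_derive_gt0_lt (fun x => x - sin x * cos x) df 0 t.
rewrite sin0 mul0r subr0; apply => //.
move=> x /[!in_itv]/= /andP[x0 xt].
have -> : df x = 2 * sin x ^+ 2 by rewrite /df -[X in X - _](cos2Dsin2 x); ring.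
by rewrite mulr_gt0 // exprn_gt0 // sin_gt0_pi; lra.
Qed.

Definition arccot q := pi / 2 - atan q.

Lemma arccot_itv q : 0 < arccot q < pi.
Proof.
have := atan_ltpi2 q; have := atan_gtNpi2 q; rewrite /arccot; lra.
Qed.

Lemma sqrt1D_gt0 x : 0 < Num.sqrt (1 + x ^+ 2).
Proof. by rewrite sqrtr_gt0 ltr_pwDl // sqr_ge0. Qed.

Lemma sqr_sqrt1D x : Num.sqrt (1 + x ^+ 2) ^+ 2 = 1 + x ^+ 2.
Proof. by rewrite sqr_sqrtr // addr_ge0 // sqr_ge0. Qed.

Lemma sin_atan x : sin (atan x) = x / Num.sqrt (1 + x ^+ 2).
Proof.
have := atanK x; rewrite /tan cos_atan.
have := sqrt1D_gt0 x; set s := Num.sqrt _ => s0 e.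
by rewrite -[in RHS]e; field; rewrite gt_eqF.
Qed.

Lemma sin_arccot q : sin (arccot q) = (Num.sqrt (1 + q ^+ 2))^-1.
Proof. by rewrite /arccot sinB sin_pihalf cos_pihalf cos_atan; ring. Qed.

Lemma cos_arccot q : cos (arccot q) = q / Num.sqrt (1 + q ^+ 2).
Proof. by rewrite /arccot cosB sin_pihalf cos_pihalf sin_atan; ring. Qed.

(** With theta = arccot q this is sin theta cos theta < theta: it is the
    only inequality behind the monotonicity of the bigon curvature. *)
Lemma arccot_gt q : q / (1 + q ^+ 2) < arccot q.
Proof.
have := sinM_cos_lt (arccot_itv q).
rewrite sin_arccot cos_arccot -{3}(sqr_sqrt1D q).
have := sqrt1D_gt0 q; set s := Num.sqrt _ => s0.
by rewrite [X in X < _ -> _](_ : _ = q / s ^+ 2) //; field; rewrite gt_eqF.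
Qed.

Lemma is_derive_arccot (f : R -> R) x df : is_derive x 1 f df ->
  is_derive x 1 (fun z => arccot (f z)) (- (df / (1 + f x ^+ 2))).
Proof.
move=> fdf; rewrite /arccot.
have h : is_derive x 1 (atan \o f) ((1 + f x ^+ 2)^-1 * df).
  exact: is_derive1_comp.
by apply: is_derive_eq; rewrite add0r mul1r mulrC.
Qed.

Lemma is_derive_sqrt1D x :
  is_derive x 1 (fun z : R => Num.sqrt (1 + z ^+ 2)) (x / Num.sqrt (1 + x ^+ 2)).
Proof.
have h : is_derive x 1 (Num.sqrt \o (fun z : R => 1 + z ^+ 2))
   ((2 * Num.sqrt (1 + x ^+ 2))^-1 * (2 * x)).
  apply: is_derive1_comp.
    by apply: is_derive1_sqrt; rewrite ltr_pwDl // sqr_ge0.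
  by apply: is_derive_eq; rewrite add0r /GRing.scale /=; ring.
by apply: is_derive_eq; have := sqrt1D_gt0 x => s0; field; rewrite gt_eqF.
Qed.

Lemma is_derive_div (f g : R -> R) x df dg : g x != 0 ->
  is_derive x 1 f df -> is_derive x 1 g dg ->
  is_derive x 1 (fun z => f z / g z) ((df * g x - f x * dg) / g x ^+ 2).
Proof.
move=> gx0 fdf gdg; have h := is_deriveV gx0 gdg.
by apply: is_derive_eq; rewrite /GRing.scale /=; field.
Qed.

(** The cotangent of half the angle that the side of the bigon subtends at the
    center of the disk of curvature x; see [disk_circle1E]. *)
Definition side_slope phi x y :=
  (x * cos phi + y) / (Num.sqrt (1 + x ^+ 2) * sin phi).

Definition side_curvature phi x y :=
  2 * (x / Num.sqrt (1 + x ^+ 2)) * arccot (side_slope phi x y).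

Definition bigon_curvature phi x y :=
  side_curvature phi x y + side_curvature phi y x.

Section Monotone.
Variable phi : R.
Hypothesis phi_itv : 0 < phi < pi / 2.

Let sin_phi : 0 < sin phi.
Proof. exact: sin_gt0_pihalf. Qed.

(** For the slopes q of both sides, 1 + q ^ 2 has the same numerator D, symmetric
    in x and y; this is why the rational parts of the two derivatives add up
    to the single term q / (1 + q ^ 2) of the side on the first disk. *)
Lemma is_derive_bigon_curvature x y :
  is_derive x 1 (fun z => bigon_curvature phi z y)
    (2 / Num.sqrt (1 + x ^+ 2) ^+ 3 *
      (arccot (side_slope phi x y) -
       side_slope phi x y / (1 + side_slope phi x y ^+ 2))).
Proof.
rewrite /bigon_curvature /side_curvature.
have d1 := is_derive_sqrt1D x.
set sx := Num.sqrt (1 + x ^+ 2) in d1 *.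
set sy := Num.sqrt (1 + y ^+ 2).
have sx0 : 0 < sx by apply: sqrt1D_gt0.
have sy0 : 0 < sy by apply: sqrt1D_gt0.
have e : sx ^+ 2 - x ^+ 2 = 1 by rewrite sqr_sqrt1D; ring.
have d2 : is_derive x 1 (fun z => z / Num.sqrt (1 + z ^+ 2)) (sx ^- 3).
  apply: is_derive_eq.
    by apply: (is_derive_div (f := id)); rewrite gt_eqF.
  rewrite /= -/sx mul1r.
  have -> : sx - x * (x / sx) = (sx ^+ 2 - x ^+ 2) / sx by field; rewrite gt_eqF.
  by rewrite e; field; rewrite gt_eqF.
have d3 : is_derive x 1 (fun z => side_slope phi z y)
    ((cos phi - x * y) / (sx ^+ 3 * sin phi)).
  rewrite /side_slope; apply: is_derive_eq.
    apply: (is_derive_div (f := fun z => z * cos phi + y)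
      (g := fun z => Num.sqrt (1 + z ^+ 2) * sin phi)).
    by rewrite gt_eqF // mulr_gt0.
  rewrite /GRing.scale /= -/sx.
  transitivity ((cos phi * (sx ^+ 2 - x ^+ 2) - x * y) / (sx ^+ 3 * sin phi)).
    by field; rewrite !gt_eqF.
  by rewrite e; congr (_ / _); ring.
have d4 : is_derive x 1 (fun z => side_slope phi y z) (sy * sin phi)^-1.
  by rewrite /side_slope -/sy; apply: is_derive_eq; rewrite /GRing.scale /=; ring.
have d5 := is_derive_arccot d3.
have d6 := is_derive_arccot d4.
apply: is_derive_eq.
rewrite /GRing.scale /= -/sx -/sy.
have ex := sqr_sqrt1D x; rewrite -/sx in ex.
have ey := sqr_sqrt1D y; rewrite -/sy in ey.
have ec := cos2Dsin2 phi.
set A := arccot _.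
pose D := x ^+ 2 + y ^+ 2 + 2 * x * y * cos phi + sin phi ^+ 2.
(* Both identities use cos phi ^ 2 + sin phi ^ 2 = 1. *)
have D1 : 1 + side_slope phi x y ^+ 2 = D / (sx * sin phi) ^+ 2.
  rewrite /side_slope -/sx; apply: (canRL (mulfK _)).
    by rewrite gt_eqF // exprn_gt0 // mulr_gt0.
  transitivity (sx ^+ 2 * sin phi ^+ 2 + (x * cos phi + y) ^+ 2).
    by field; rewrite !gt_eqF.
  rewrite ex /D.
  transitivity (sin phi ^+ 2 + x ^+ 2 * (cos phi ^+ 2 + sin phi ^+ 2) + y ^+ 2 +
    2 * x * y * cos phi); first by ring.
  by rewrite ec; ring.
have D2 : 1 + side_slope phi y x ^+ 2 = D / (sy * sin phi) ^+ 2.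
  rewrite /side_slope -/sy; apply: (canRL (mulfK _)).
    by rewrite gt_eqF // exprn_gt0 // mulr_gt0.
  transitivity (sy ^+ 2 * sin phi ^+ 2 + (y * cos phi + x) ^+ 2).
    by field; rewrite !gt_eqF.
  rewrite ey /D.
  transitivity (sin phi ^+ 2 + y ^+ 2 * (cos phi ^+ 2 + sin phi ^+ 2) + x ^+ 2 +
    2 * x * y * cos phi); first by ring.
  by rewrite ec; ring.
have D0 : 0 < D.
  have : 0 < D / (sx * sin phi) ^+ 2.
    by rewrite -D1 ltr_pwDl // sqr_ge0.
  by rewrite pmulr_lgt0 // invr_gt0 exprn_gt0 // mulr_gt0.
rewrite D1 D2 /side_slope -/sx.
transitivity (2 / sx ^+ 3 * A -
  2 * sin phi * (x * (cos phi - x * y) + y * sx ^+ 2) / (sx ^+ 2 * D)).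
  by field; rewrite !gt_eqF.
have -> : x * (cos phi - x * y) + y * sx ^+ 2 = x * cos phi + y.
  by rewrite ex; ring.
by field; rewrite !gt_eqF.
Qed.

Lemma bigon_curvatureC x y : bigon_curvature phi x y = bigon_curvature phi y x.
Proof. by rewrite /bigon_curvature addrC. Qed.

Lemma bigon_curvature_ltl x x' y : x < x' ->
  bigon_curvature phi x y < bigon_curvature phi x' y.
Proof.
move=> xx'; apply: (is_derive_gt0_lt (f := fun z => bigon_curvature phi z y)) xx'.
  by move=> z; apply: is_derive_bigon_curvature.
move=> z _ /=; rewrite mulr_gt0 ?divr_gt0 ?exprn_gt0 ?sqrt1D_gt0 //.
by rewrite subr_gt0 arccot_gt.
Qed.

Lemma bigon_curvature_lt2 x x' y y' : x < x' -> y < y' ->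
  bigon_curvature phi x y < bigon_curvature phi x' y'.
Proof.
move=> xx' yy'; apply: (lt_trans (bigon_curvature_ltl y xx')).
rewrite bigon_curvatureC [ltRHS]bigon_curvatureC.
exact: bigon_curvature_ltl.
Qed.

Lemma side_curvature_ler x y y' : 0 <= x -> y <= y' ->
  side_curvature phi x y' <= side_curvature phi x y.
Proof.
move=> x0 yy'; rewrite ler_wpM2l //.
  by rewrite mulr_ge0 // divr_ge0 // ltW // sqrt1D_gt0.
rewrite lerB // le_atan // ler_wpM2r ?lerD2l //.
by rewrite invr_ge0 ltW // mulr_gt0 // sqrt1D_gt0.
Qed.

Lemma side_curvature_gt0 x y : 0 < x -> 0 < side_curvature phi x y.
Proof.
move=> x0; have /andP[a0 _] := arccot_itv (side_slope phi x y).
by rewrite mulr_gt0 // mulr_gt0 // divr_gt0 // sqrt1D_gt0.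
Qed.

Lemma side_curvature0 y : side_curvature phi 0 y = 0.
Proof. by rewrite /side_curvature mul0r mulr0 mul0r. Qed.

(** The sum of the two sides increases with x while the other side decreases. *)
Lemma side_curvature_ltl x x' y : 0 <= y -> x < x' ->
  side_curvature phi x y < side_curvature phi x' y.
Proof.
move=> y0 xx'; have := bigon_curvature_ltl y xx'; rewrite /bigon_curvature.
have := side_curvature_ler y0 (ltW xx'); lra.
Qed.

End Monotone.
End SideCurvature.

(** * Behaviour of the curvature at infinity *)

Section Limits.
Variable R : realType.
Implicit Types (x y t : R).
Variable phi : R.
Hypothesis phi_itv : 0 < phi < pi / 2.

Let sin_phi : 0 < sin phi.
Proof. exact: sin_gt0_pihalf. Qed.

(** The side curvature in homogeneous coordinates, T(x, y) being its value at
    (1 : x : y). It extends continuously to w = 0, so that the limits at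
    infinity become values: (0 : 1 : 0) for y fixed, (0 : 1 : 1) on the
    diagonal. *)
Definition hom_side_curvature phi w x y : R :=
  let h := Num.sqrt (w ^+ 2 + x ^+ 2) in
  2 * (x / h) * arccot ((x * cos phi + y) / (h * sin phi)).

Lemma side_curvature_hom x y z : 0 < z ->
  side_curvature phi x y = hom_side_curvature phi z^-1 (x / z) (y / z).
Proof.
move=> z0; rewrite /side_curvature /side_slope /hom_side_curvature.
have -> : z^-1 ^+ 2 + (x / z) ^+ 2 = (1 + x ^+ 2) / z ^+ 2.
  by field; rewrite gt_eqF.
rewrite sqrtrM ?addr_ge0 ?sqr_ge0 // -exprVn sqrtr_sqr.
rewrite ger0_norm ?invr_ge0 1?ltW //.
have := sqrt1D_gt0 x; set s := Num.sqrt _ => s0.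
congr (2 * _ * arccot _); by field; rewrite !gt_eqF.
Qed.

Lemma cvg_hom_side_curvature (T : Type) (F : set_system T) (FF : Filter F)
    (w x y : T -> R) (a b c : R) : 0 < a ^+ 2 + b ^+ 2 ->
  w t @[t --> F] --> a -> x t @[t --> F] --> b -> y t @[t --> F] --> c ->
  hom_side_curvature phi (w t) (x t) (y t) @[t --> F]
    --> hom_side_curvature phi a b c.
Proof.
move=> ab0 wa xb yc; rewrite /hom_side_curvature.
have h : Num.sqrt (w t ^+ 2 + x t ^+ 2) @[t --> F]
    --> Num.sqrt (a ^+ 2 + b ^+ 2).
  have c2 : w t ^+ 2 + x t ^+ 2 @[t --> F] --> a ^+ 2 + b ^+ 2.
    by apply: cvgD; rewrite !expr2; apply: cvgM.
  exact: (continuous_cvg FF (@sqrt_continuous R _) c2).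
have h0 : 0 < Num.sqrt (a ^+ 2 + b ^+ 2) by rewrite sqrtr_gt0.
apply: cvgM.
  apply: cvgM; first exact: cvg_cst.
  by apply: cvgM => //; apply: cvgV => //; rewrite gt_eqF.
apply: cvgB; first exact: cvg_cst.
have c2 : (x t * cos phi + y t) / (Num.sqrt (w t ^+ 2 + x t ^+ 2) * sin phi)
    @[t --> F] --> (b * cos phi + c) / (Num.sqrt (a ^+ 2 + b ^+ 2) * sin phi).
  apply: cvgM.
    by apply: cvgD => //; apply: cvgM => //; exact: cvg_cst.
  apply: cvgV; first by rewrite gt_eqF // mulr_gt0.
  by apply: cvgM => //; exact: cvg_cst.
exact: (continuous_cvg FF (@continuous_atan R _) c2).
Qed.

Lemma continuous_side_curvature (f g : R -> R) :
  continuous f -> continuous g ->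
  continuous (fun t => side_curvature phi (f t) (g t)).
Proof.
move=> cf cg t.
have e s : side_curvature phi (f s) (g s) = hom_side_curvature phi 1 (f s) (g s).
  by rewrite (side_curvature_hom _ _ ltr01) invr1 !mulr1.
rewrite /continuous_at e (eq_cvg _ _ e).
apply: cvg_hom_side_curvature; first by rewrite ltr_wpDr ?sqr_ge0 ?expr1n.
- exact: cvg_cst.
- exact: cf.
- exact: cg.
Qed.

Lemma arccot_cot t : 0 < t < pi -> arccot (cos t / sin t) = t.
Proof.
move=> t0; rewrite /arccot.
have -> : cos t / sin t = tan (pi / 2 - t).
  by rewrite /tan cosB sinB cos_pihalf sin_pihalf; congr (_ / _); ring.
by rewrite tanK ?in_itv /=; lra.
Qed.

Lemma cvgy_inv : (x^-1) @[x --> +oo] --> (0 : R).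
Proof.
apply/gtr0_cvgV0; last exact: cvg_id.
exact: nbhs_pinfty_gt.
Qed.

Lemma cvgy_side_curvature y :
  side_curvature phi x y @[x --> +oo] --> 2 * phi.
Proof.
have -> : 2 * phi = hom_side_curvature phi 0 1 0.
  rewrite /hom_side_curvature expr0n expr1n add0r sqrtr1 divr1 mulr1 !mul1r addr0.
  by rewrite arccot_cot //; move: phi_itv; lra.
have c : hom_side_curvature phi x^-1 1 (y / x) @[x --> +oo]
    --> hom_side_curvature phi 0 1 0.
  apply: cvg_hom_side_curvature.
  - by rewrite expr0n expr1n add0r.
  - exact: cvgy_inv.
  - exact: cvg_cst.
  - by rewrite -(mulr0 y); apply: cvgM; [exact: cvg_cst|exact: cvgy_inv].
apply: cvg_trans c; apply: near_eq_cvg; near=> x.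
have x0 : 0 < x by near: x; exact: nbhs_pinfty_gt.
by rewrite (side_curvature_hom _ _ x0) divff // gt_eqF.
Unshelve. all: by end_near. Qed.

Lemma cvgy_bigon_curvature :
  bigon_curvature phi x x @[x --> +oo] --> 2 * phi.
Proof.
(* (1 + cos phi) / sin phi is the cotangent of phi / 2. *)
have e : phi = hom_side_curvature phi 0 1 1.
  rewrite /hom_side_curvature expr0n expr1n add0r sqrtr1 divr1 mulr1 !mul1r.
  pose t := phi / 2.
  have t0 : 0 < t < pi by move: phi_itv; rewrite /t; lra.
  have ct : 0 < cos t by apply: cos_gt0_pihalf; move: phi_itv; rewrite /t; lra.
  have st : 0 < sin t by apply: sin_gt0_pi.
  have -> : (cos phi + 1) / sin phi = cos t / sin t.
    have -> : phi = t + t by rewrite /t; field.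
    rewrite cosD sinD -[X in _ + X](cos2Dsin2 t).
    by field; rewrite !gt_eqF // addr_gt0 // mulr_gt0.
  by rewrite arccot_cot // /t; field.
have c : hom_side_curvature phi x^-1 1 1 @[x --> +oo]
    --> hom_side_curvature phi 0 1 1.
  apply: cvg_hom_side_curvature.
  - by rewrite expr0n expr1n add0r.
  - exact: cvgy_inv.
  - exact: cvg_cst.
  - exact: cvg_cst.
have -> : 2 * phi = phi + phi by ring.
rewrite {2 3}e.
apply: cvg_trans (cvgD c c); apply: near_eq_cvg; near=> x.
have x0 : 0 < x by near: x; exact: nbhs_pinfty_gt.
by rewrite /bigon_curvature (side_curvature_hom _ _ x0) divff // gt_eqF.
Unshelve. all: by end_near. Qed.

(** An increasing function stays strictly below its limit; the limit is only
    known on the diagonal, which eventually dominates (x + 1, y). *)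
Lemma bigon_curvature_lt x y : bigon_curvature phi x y < 2 * phi.
Proof.
have x1 : x < x + 1 by rewrite ltrDl.
apply: (lt_le_trans (bigon_curvature_ltl phi_itv y x1)).
apply: (cvgr_to_ge cvgy_bigon_curvature); near=> z.
have xz : x + 1 < z by near: z; apply: nbhs_pinfty_gt; exact: num_real.
have yz : y < z by near: z; apply: nbhs_pinfty_gt; exact: num_real.
apply: (le_trans (ltW (bigon_curvature_ltl phi_itv y xz))).
rewrite bigon_curvatureC ltW //; exact: bigon_curvature_ltl.
Unshelve. all: by end_near. Qed.

End Limits.

(** * The length of a side of a bigon *)

Section SideLength.
Variable R : realType.
Implicit Types (x y q t phi : R).

Lemma dot_unit_itv (u v : 'rV[R]_3) : unit_sphere u -> unit_sphere v ->
  -1 <= dot u v <= 1.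
Proof.
rewrite /unit_sphere /= => u1 v1.
(* The squared norm of u + e v, for e = 1 and e = -1. *)
have h (e : R) : 0 <= dot u u + e * e * dot v v + 2 * e * dot u v.
  have -> : dot u u + e * e * dot v v + 2 * e * dot u v =
      \sum_i (u 0 i + e * v 0 i) ^+ 2.
    rewrite /dot !mulr_sumr -!big_split /=.
    by apply: eq_bigr => i _; ring.
  by apply: sumr_ge0 => i _; apply: sqr_ge0.
by have := h 1; have := h (-1); rewrite u1 v1; lra.
Qed.

Lemma disk_unitE (c z : 'rV[R]_3) r : unit_sphere c -> unit_sphere z ->
  0 <= r <= pi -> disk c r z <-> cos r <= dot c z.
Proof.
move=> c1 z1 rpi; have d1 := dot_unit_itv c1 z1.
have dpi : 0 <= acos (dot c z) <= pi by rewrite acos_ge0 // acos_lepi.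
have <- : (acos (dot c z) <= r) = (cos r <= dot c z).
  by rewrite !leNgt -[in RHS](acosK (x := dot c z)) ?in_itv //= ltr_cos ?in_itv.
by split=> [[]|].
Qed.

Lemma center2_unit r phi : unit_sphere (center2 r phi).
Proof.
rewrite /unit_sphere /= /center2 dot_vec3; set a := pi - phi.
transitivity (sin r ^+ 2 * (cos a ^+ 2 + sin a ^+ 2) + cos r ^+ 2).
  by ring.
by rewrite cos2Dsin2 mulr1 addrC cos2Dsin2.
Qed.

Lemma dot_center2_circle1 r1 r2 phi t :
  dot (center2 r2 phi) (circle1 r1 t) = cos r2 +
    sin r1 * ((cos r1 * sin r2 * cos phi + sin r1 * cos r2) * (cos t - 1) +
      sin r2 * sin phi * sin t).
Proof.
rewrite /center2 /circle1 /center1 !(scalev3, addv3) dot_vec3.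
rewrite cosB sinB cospi sinpi.
transitivity (cos r2 * (cos r1 ^+ 2 + sin r1 ^+ 2) +
    sin r1 * ((cos r1 * sin r2 * cos phi + sin r1 * cos r2) * (cos t - 1) +
      sin r2 * sin phi * sin t)); first by ring.
by rewrite cos2Dsin2 mulr1.
Qed.

Lemma sin_halfM_ge0 (u theta : R) : 0 <= u < pi -> 0 < theta < pi ->
  (0 <= sin u * sin (theta - u)) = (u <= theta).
Proof.
move=> u0 th0; have [uth|thu] := leP u theta.
  by rewrite mulr_ge0 // sin_ge0_pi; lra.
apply/negbTE; rewrite -ltNge -[theta - u]opprB sinN mulrN oppr_lt0.
by rewrite mulr_gt0 // sin_gt0_pi; lra.
Qed.

Lemma sin_radius x : sin (Defs.radius x) = (Num.sqrt (1 + x ^+ 2))^-1.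
Proof. exact: sin_arccot. Qed.

Lemma cos_radius x : cos (Defs.radius x) = x / Num.sqrt (1 + x ^+ 2).
Proof. exact: cos_arccot. Qed.

(** Both circles pass through the point of parameter 0, so the condition on t
    has no constant term; passing to u = t / 2 it factors, up to a positive
    constant, as sin u * sin (theta - u) >= 0, where theta is the arccotangent
    of the slope. *)
Lemma disk_circle1E x y phi t : 0 <= x -> 0 <= y -> 0 < phi < pi ->
  0 <= t < 2 * pi ->
  disk (center2 (Defs.radius y) phi) (Defs.radius y) (circle1 (Defs.radius x) t) <->
  t <= 2 * arccot (side_slope phi x y).
Proof.
move=> x0 y0 phi_itv t_itv.
have sin_phi : 0 < sin phi by apply: sin_gt0_pi.
rewrite disk_unitE; first last.
- by have := radius_itv y0; have := pi_gt0 R; lra.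
- exact: circle1_unit.
- exact: center2_unit.
rewrite dot_center2_circle1 lerDl !sin_radius !cos_radius.
set q := side_slope phi x y; set sx := Num.sqrt (1 + x ^+ 2).
set sy := Num.sqrt (1 + y ^+ 2); set th := arccot q.
have sx0 : 0 < sx by apply: sqrt1D_gt0.
have sy0 : 0 < sy by apply: sqrt1D_gt0.
have sq0 : 0 < Num.sqrt (1 + q ^+ 2) by apply: sqrt1D_gt0.
have th_itv : 0 < th < pi by apply: arccot_itv.
pose u := t / 2.
have u_itv : 0 <= u < pi by rewrite /u; lra.
have -> : (t <= 2 * th) = (u <= th) by apply/idP/idP; rewrite /u; lra.
rewrite -(sin_halfM_ge0 u_itv th_itv).
have tE : t = u + u by rewrite /u; field.
have cE : cos t - 1 = - 2 * sin u ^+ 2.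
  by rewrite tE cosD -[X in _ - X](cos2Dsin2 u); ring.
have sE : sin t = 2 * sin u * cos u by rewrite tE sinD; ring.
rewrite cE sE sinB sin_arccot cos_arccot.
have -> : sx^-1 * ((x / sx / sy * cos phi + sx^-1 * (y / sy)) *
       (-2 * sin u ^+ 2) + sy^-1 * sin phi * (2 * sin u * cos u)) =
   (2 * sin phi * Num.sqrt (1 + q ^+ 2) / (sx * sy)) *
   (sin u * ((Num.sqrt (1 + q ^+ 2))^-1 * cos u -
      q / Num.sqrt (1 + q ^+ 2) * sin u)).
  have qE : x * cos phi + y = q * (sx * sin phi).
    by rewrite /q /side_slope divfK // gt_eqF // mulr_gt0.
  transitivity (2 * sin u * (sx * sin phi * cos u - (x * cos phi + y) * sin u) /
    (sx ^+ 2 * sy)); first by field; rewrite !gt_eqF.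
  by rewrite qE; field; rewrite !gt_eqF.
rewrite pmulr_rge0 //.
by rewrite divr_gt0 // mulr_gt0 // mulr_gt0.
Qed.

Lemma side_lengthM x y phi : 0 <= x -> 0 <= y -> 0 < phi < pi ->
  side_length (Defs.radius x) (Defs.radius y) phi * x = side_curvature phi x y.
Proof.
move=> x0 y0 phi_itv; rewrite /side_length /side_curvature sin_radius.
set th := arccot _; have th_itv : 0 < th < pi by apply: arccot_itv.
set A := (X in lebesgue_measure X).
have -> : A = [set` `[0, 2 * th]].
  apply/seteqP; split=> t; rewrite /A /= in_itv /=.
    by move=> [t_itv /disk_circle1E -> //]; move: t_itv => /andP[-> _].
  move=> /andP[t0 tth]; have t_itv : 0 <= t < 2 * pi by rewrite t0; lra.
  by split=> //; apply/disk_circle1E.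
have th0 : 0 < 2 * th by lra.
by rewrite lebesgue_measure_itv /= lte_fin th0 oppr0 addr0 /=; ring.
Qed.

End SideLength.

(** * Edges on the boundary of a face *)

Section FaceEdges.
Variable R : realType.
Variables (S : topologicalType) (V E : finType) (n : nat).
Variable Sigma : cellular_decomposition R S V E n.

Lemma edge_nonempty e : exists x, edge Sigma e x.
Proof.
have [g [_ [[gmap _ _] _ _] _]] := edge_char Sigma e.
exists (g 0); apply: gmap; rewrite /= /sqnorm big1 ?ltr01 // => i _.
by rewrite mxE expr0n.
Qed.

Lemma cell_eq x c c' :
  cells (vertex Sigma) (edge Sigma) (face Sigma) c x ->
  cells (vertex Sigma) (edge Sigma) (face Sigma) c' x -> c = c'.
Proof.
by move=> cx c'x; apply: (@cells_disjoint _ _ _ _ _ Sigma c c' I I); exists x.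
Qed.

(** The image of U and O under the chart is open in the plane, so it contains the
    image of x pushed a little to the side given by the sign of s. *)
Lemma plane_chart_meets (U : set S) (chart : S -> 'rV[R]_2) x (s : R) O :
  plane_chart U chart -> U x -> chart x 0 1 = 0 -> open O -> O x -> s != 0 ->
  exists y, [/\ U y, O y & 0 < s * chart y 0 1].
Proof.
move=> [_ [[_ _ chart_surj] _ chart_open]] Ux x0 Oopen Ox s0.
have [W Wopen imE] := chart_open O Oopen.
have Wx : W (chart x).
  suff: (chart @` (U `&` O)) (chart x) by rewrite imE => -[].
  by exists x.
have /nbhs_ballP[d /= d0 dW] := open_nbhs_nbhs (conj Wopen Wx).
pose z := chart x + (d / 2 * Num.sg s) *: delta_mx 0 1.
have z1 : z 0 1 = d / 2 * Num.sg s.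
  by rewrite /z !mxE x0 !eqxx mulr1 add0r.
have : (setT `&` W) z.
  split=> //; apply: dW; split=> // i j; rewrite /ball /= /z !mxE.
  rewrite opprD addrA subrr sub0r normrN normrM normrM normr_sg s0 mulr1.
  rewrite gtr0_norm ?divr_gt0 //.
  by case: (_ && _); rewrite ?normr0 ?normr1 ?mulr0 ?mulr1 //; lra.
rewrite -imE => -[y [Uy Oy] yz]; exists y; split=> //.
by rewrite yz z1 mulrCA mulr_gt0 ?divr_gt0 // mulrC -normrEsg normr_gt0.
Qed.

Lemma sub_cell_boundary e f (s : R) (s0 : s != 0) :
  (forall x, edge Sigma e x -> exists U chart, [/\ plane_chart U chart, U x,
     chart x 0 1 = 0 & forall y, U y -> 0 < s * chart y 0 1 -> face Sigma f y]) ->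
  edge Sigma e `<=` cell_boundary (face Sigma f).
Proof.
move=> h x ex; split; last first.
  by move=> fx; have := @cell_eq x (inl (inr e)) (inr f) ex fx.
have [U [chart [cU Ux x0 hf]]] := h x ex.
move=> O; rewrite nbhsE => -[W [Wopen Wx] WO].
have [y [Uy Wy y0]] := plane_chart_meets cU Ux x0 Wopen Wx s0.
by exists y; split; [exact: hf|exact: WO].
Qed.

(** Near a point of e the surface consists of e and of its two side faces:
    hence both side faces have e in their closure, and a face whose closure
    meets e must, cells being disjoint, be one of them. *)
Lemma in_face_edges f e : (e \in face_edges Sigma f) =
  (side1 Sigma e == f) || (side2 Sigma e == f).
Proof.
rewrite inE; apply/asboolP/idP => [ef|].
  have [x ex] := edge_nonempty e.
  have [U [chart [cU Ux hU]]] := sidesP ex.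
  have [cf _] := ef x ex.
  have [Uopen _] := cU.
  have [y [fy Uy]] := cf U (open_nbhs_nbhs (conj Uopen Ux)).
  have [y0 yp yn] := hU y Uy.
  have [c|c|c] := ltgtP 0 (chart y 0 1).
  - by have [->] := @cell_eq y (inr _) (inr f) (yp c) fy; rewrite eqxx.
  - by have [->] := @cell_eq y (inr _) (inr f) (yn c) fy; rewrite eqxx orbT.
  - have ey : edge Sigma e y by apply/y0.
    by have := @cell_eq y (inl (inr e)) (inr f) ey fy.
move=> /orP[] /eqP <-.
  apply: (sub_cell_boundary (s := 1)) => // x ex.
  have [U [chart [cU Ux hU]]] := sidesP ex.
  exists U, chart; split=> //; first by have [[-> ]] := hU x Ux.
  by move=> y Uy; rewrite mul1r; have [_] := hU y Uy.
apply: (sub_cell_boundary (s := -1)) => [|x ex]; first by rewrite oppr_eq0 oner_eq0.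
have [U [chart [cU Ux hU]]] := sidesP ex.
exists U, chart; split=> //; first by have [[-> ]] := hU x Ux.
by move=> y Uy; rewrite mulN1r oppr_gt0; have [_ _] := hU y Uy.
Qed.

End FaceEdges.

(** * The system of curvature equations *)

Lemma cvg_sum (R : realType) (J T : Type) (F : set_system T) (FF : Filter F)
    (r : seq J) (Q : pred J) (u : J -> T -> R) (l : J -> R) :
  (forall j, Q j -> u j t @[t --> F] --> l j) ->
  \sum_(j <- r | Q j) u j t @[t --> F] --> \sum_(j <- r | Q j) l j.
Proof. by apply: cvg_big; exact: add_continuous. Qed.

Section Network.
Variables (R : realType) (I E : finType) (a b : E -> I) (Phi : E -> R).
Hypothesis Phi_itv : forall e, 0 < Phi e < pi / 2.
Implicit Types (k : I -> R) (f g : I) (e : E) (P : {set I}).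

Local Notation T e := (side_curvature (Phi e)).

Definition face_curvature k f : R := \sum_e
  ((if a e == f then T e (k (a e)) (k (b e)) else 0) +
   (if b e == f then T e (k (b e)) (k (a e)) else 0)).

Definition edge_part P k e : R :=
  (if a e \in P then T e (k (a e)) (k (b e)) else 0) +
  (if b e \in P then T e (k (b e)) (k (a e)) else 0).

Definition incident P e := (a e \in P) || (b e \in P).

Lemma sum_face_curvature P k :
  \sum_(f in P) face_curvature k f = \sum_e edge_part P k e.
Proof.
rewrite exchange_big; apply: eq_bigr => e _; rewrite big_split /=.
have sum_if (h : I) (c : R) :
    \sum_(f in P) (if h == f then c else 0) = if h \in P then c else 0.
  rewrite -big_mkcondr /=; case: ifP => hP.
    by rewrite (big_pred1 h) // => f /=; case: eqVneq => [<-|]; rewrite ?hP ?andbF.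
  by rewrite big1 // => f /andP[fP /eqP hf]; rewrite hf fP in hP.
by rewrite !sum_if.
Qed.

Lemma edge_part0 P k e : ~~ incident P e -> edge_part P k e = 0.
Proof.
by rewrite /edge_part negb_or => /andP[/negbTE -> /negbTE ->]; rewrite addr0.
Qed.

(** The monotonicity on which Perron's method rests: enlarging the other
    coordinates lowers the curvature of f. *)
Lemma face_curvature_anti k k' f : 0 <= k f -> k f = k' f ->
  (forall g, k g <= k' g) -> face_curvature k' f <= face_curvature k f.
Proof.
move=> kf0 kf kk'; apply: ler_sum => e _; apply: lerD; case: eqP => // ef.
  by rewrite ef -kf side_curvature_ler.
by rewrite ef -kf side_curvature_ler.
Qed.

(** The key comparison for uniqueness: when P is the set where k exceeds k',
    every edge around P contributes more to P for k than for k'. For an edge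
    with one side outside P both the larger first argument and the smaller
    second one increase the side curvature. *)
Lemma edge_part_lt P k k' e : (forall f, 0 <= k f) -> (forall f, 0 <= k' f) ->
  (forall f, f \in P -> k' f < k f) -> (forall f, f \notin P -> k f <= k' f) ->
  incident P e -> edge_part P k' e < edge_part P k e.
Proof.
move=> k0 k'0 kin kout; rewrite /incident /edge_part.
have one f g : f \in P -> g \notin P -> T e (k' f) (k' g) < T e (k f) (k g).
  move=> fP gP.
  apply: le_lt_trans (side_curvature_ler (Phi_itv e) (k'0 f) (kout g gP)) _.
  by apply: side_curvature_ltl => //; exact: kin.
case: ifPn => aP; case: ifPn => bP // _.
- by apply: (bigon_curvature_lt2 (Phi_itv e)); exact: kin.
- by rewrite !addr0 one.
- by rewrite !add0r one.
Qed.

Hypothesis face_incident : forall f, exists e, (a e == f) || (b e == f).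

Lemma incident_exists P f : f \in P -> exists e, incident P e.
Proof.
move=> fP; have [e ef] := face_incident f; exists e; rewrite /incident.
by case/orP: ef => /eqP ->; rewrite fP ?orbT.
Qed.

Lemma face_curvature_inj_le k k' :
  (forall f, 0 <= k f) -> (forall f, 0 <= k' f) ->
  (forall f, face_curvature k f = face_curvature k' f) ->
  forall f, k f <= k' f.
Proof.
move=> k0 k'0 kk' f; rewrite leNgt; apply/negP => ff.
pose P := [set f | k' f < k f]%SET.
have fP : f \in P by rewrite inE.
have [e eP] := incident_exists fP.
have lt_part e' : incident P e' -> edge_part P k' e' < edge_part P k e'.
  by apply: edge_part_lt => // g; rewrite inE // -leNgt.
suff : \sum_(f in P) face_curvature k' f < \sum_(f in P) face_curvature k f.
  by rewrite (eq_bigr _ (fun f _ => kk' f)) ltxx.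
rewrite !sum_face_curvature (bigD1 e) //= [ltRHS](bigD1 e) //=.
apply: ltr_leD; first exact: lt_part.
apply: ler_sum => e' _; have [e'P|e'P] := boolP (incident P e').
  exact/ltW/lt_part.
by rewrite !edge_part0.
Qed.

Lemma face_curvature_inj k k' :
  (forall f, 0 <= k f) -> (forall f, 0 <= k' f) ->
  (forall f, face_curvature k f = face_curvature k' f) -> k =1 k'.
Proof.
move=> k0 k'0 kk' f; apply/eqP; rewrite eq_le.
by rewrite !face_curvature_inj_le.
Qed.

Lemma side_curvature_ge0 e x y : 0 <= x -> 0 <= T e x y.
Proof.
rewrite le_eqVlt => /predU1P[<-|x0]; first by rewrite side_curvature0.
exact/ltW/side_curvature_gt0.
Qed.

Lemma face_curvature_ge0 k f : (forall g, 0 <= k g) -> 0 <= face_curvature k f.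
Proof.
move=> k0; apply: sumr_ge0 => e _.
by apply: addr_ge0; case: ifP => // _; apply: side_curvature_ge0.
Qed.

Lemma face_curvature0 k f : k f = 0 -> face_curvature k f = 0.
Proof.
move=> kf; rewrite /face_curvature big1 // => e _.
by case: eqP => [->|_]; case: eqP => [->|_]; rewrite ?kf ?side_curvature0 addr0.
Qed.

Lemma face_curvature_gt0 k f :
  (forall g, 0 <= k g) -> 0 < k f -> 0 < face_curvature k f.
Proof.
move=> k0 kf; have [e ef] := face_incident f.
have part0 e' : 0 <= (if a e' == f then T e' (k (a e')) (k (b e')) else 0) /\
                0 <= (if b e' == f then T e' (k (b e')) (k (a e')) else 0).
  by split; case: ifP => // _; apply: side_curvature_ge0.
rewrite /face_curvature (bigD1 e) //= ltr_pwDl //; last first.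
  by apply: sumr_ge0 => e' _; have [? ?] := part0 e'; exact: addr_ge0.
have [pa pb] := part0 e.
case/orP: ef => /eqP ef.
  by apply: ltr_pwDl => //; rewrite ef eqxx side_curvature_gt0.
by apply: ltr_pwDr => //; rewrite ef eqxx side_curvature_gt0.
Qed.

Lemma edge_part_lt_angle P k e : (forall f, 0 <= k f) ->
  edge_part P k e < 2 * Phi e.
Proof.
move=> k0.
apply: le_lt_trans (bigon_curvature_lt (Phi_itv e) (k (a e)) (k (b e))).
by apply: lerD; case: ifP => // _; apply: side_curvature_ge0.
Qed.

Lemma sum_face_curvature_lt P k : (forall f, 0 <= k f) -> P != finset.set0 ->
  \sum_(f in P) face_curvature k f < 2 * \sum_(e | incident P e) Phi e.
Proof.
move=> k0 /set0Pn[f fP]; have [e eP] := incident_exists fP.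
rewrite sum_face_curvature mulr_sumr (bigID (incident P)) /=.
rewrite [X in _ + X]big1 ?addr0; last by move=> e'; exact: edge_part0.
apply: ltr_sum => [|e' e'P]; last exact: edge_part_lt_angle.
by apply/hasP; exists e => //; rewrite mem_index_enum.
Qed.

Section Existence.
Variable L : I -> R.
Hypothesis L_ge0 : forall f, 0 <= L f.
(* This covers prescribed curvatures with zeros: only sets of faces in the
   support of L are constrained. *)
Hypothesis L_lt : forall P, P != finset.set0 -> (forall f, f \in P -> 0 < L f) ->
  \sum_(f in P) L f < 2 * \sum_(e | incident P e) Phi e.

Definition subsolution k :=
  (forall f, 0 <= k f) /\ (forall f, face_curvature k f <= L f).

Lemma subsolution0 : subsolution (fun=> 0).
Proof. by split=> // f; rewrite face_curvature0. Qed.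

Lemma edge_part_ge P k e B z : (forall f, 0 <= k f) ->
  0 <= z -> (forall f, f \notin P -> k f <= B) -> (forall f, f \in P -> z < k f) ->
  incident P e ->
  (if (a e \in P) && (b e \in P) then bigon_curvature (Phi e) z z
   else T e z B) <= edge_part P k e.
Proof.
move=> k0 z0 kB zk; rewrite /incident /edge_part.
have one f g : f \in P -> g \notin P -> T e z B <= T e (k f) (k g).
  move=> fP gP; apply: (le_trans (side_curvature_ler (Phi_itv e) z0 (kB g gP))).
  by apply/ltW/side_curvature_ltl => //; exact: zk.
have [aP|aP] := boolP (a e \in P); have [bP|bP] := boolP (b e \in P) => //= _.
- by apply: ltW; apply: (bigon_curvature_lt2 (Phi_itv e)); exact: zk.
- by rewrite addr0 one.
- by rewrite add0r one.
Qed.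

Lemma cvgy_edge_part_bound P B :
  (\sum_(e | incident P e)
    (if (a e \in P) && (b e \in P) then bigon_curvature (Phi e) z z
     else T e z B)) @[z --> +oo] --> 2 * \sum_(e | incident P e) Phi e.
Proof.
rewrite mulr_sumr; apply: cvg_sum => e _; case: (_ && _).
  exact: cvgy_bigon_curvature.
exact: cvgy_side_curvature.
Qed.

(** Where the finiteness condition is used. If k is bounded by B outside P and
    larger than z on P, then its curvature over P is at least a quantity that
    tends, with z, to the bound in [L_lt]; so z cannot be too large. When L
    vanishes at a face of P, already k vanishes there. *)
Lemma subsolution_gap P B : P != finset.set0 -> exists M, forall k, subsolution k ->
  (forall f, f \notin P -> k f <= B) -> exists2 f, f \in P & k f <= M.
Proof.
move=> P0; have [LP|/existsNP[f /not_implyP[fP /negP]]] :=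
  pselect (forall f, f \in P -> 0 < L f); last first.
  rewrite -leNgt => Lf; exists 0 => k [k0 kL] _; exists f => //.
  rewrite leNgt; apply/negP => kf.
  by have := lt_le_trans (face_curvature_gt0 k0 kf) (le_trans (kL f) Lf); rewrite ltxx.
have [M [M0 LM]] : exists M, 0 <= M /\ \sum_(f in P) L f <
    \sum_(e | incident P e)
    (if (a e \in P) && (b e \in P) then bigon_curvature (Phi e) M M
     else T e M B).
  near (+oo : set_system R) => z; exists z; split.
    by near: z; apply: nbhs_pinfty_ge; exact: num_real.
  near: z; apply: (cvgr_gt _ (@cvgy_edge_part_bound P B)).
  exact: L_lt.
exists M => k [k0 kL] kB; apply: contrapT => nf.
have kM f : f \in P -> M < k f.
  by move=> fP; rewrite ltNge; apply/negP => kf; apply: nf; exists f.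
suff : \sum_(f in P) L f < \sum_(f in P) L f by rewrite ltxx.
apply: (lt_le_trans LM); apply: (@le_trans _ _ (\sum_(f in P) face_curvature k f)).
  rewrite sum_face_curvature [leRHS](bigID (incident P)) /=.
  rewrite [X in _ + X]big1 ?addr0; last by move=> e; exact: edge_part0.
  by apply: ler_sum => e; apply: edge_part_ge.
by apply: ler_sum => f _; exact: kL.
Unshelve. all: by end_near. Qed.

(** Bounds one more coordinate at a time: apply [subsolution_gap] to the set P
    of the coordinates that exceed the current bound. The set P depends on k,
    so the new bound must serve for all the finitely many P at once. *)
Lemma subsolution_card_bounded m : (m <= #|I|)%N -> exists B : R, forall k,
  subsolution k -> (m <= #|[set f | (k f <= B)%R]%SET|)%N.
Proof.
elim: m => [|m IHm] mI; first by exists 0.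
have [B Bk] := IHm (ltnW mI).
have /choice[M MP] (P : {set I}) : exists M, P != finset.set0 -> forall k,
    subsolution k -> (forall f, f \notin P -> k f <= B) ->
    exists2 f, f \in P & k f <= M.
  have [->|P0] := eqVneq P finset.set0; first by exists 0.
  by have [M MP] := subsolution_gap B P0; exists M.
exists (`|B| + \sum_P `|M P|) => k sk.
set B' := `|B| + _.
have BB' : B <= B' by rewrite (le_trans (ler_norm B)) // lerDl sumr_ge0.
pose P := [set f | B < k f]%SET.
have [P0|P0] := eqVneq P finset.set0.
  suff -> : [set f | k f <= B']%SET = [set: I]%SET by rewrite cardsT.
  apply/setP => f; rewrite !inE.
  have : f \notin P by rewrite P0 inE.
  by rewrite inE -leNgt => /le_trans ->.
have [|f fP kf] := MP P P0 k sk; first by move=> f; rewrite inE -leNgt.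
have kfB : k f <= B'.
  apply: (le_trans kf); apply: (le_trans (ler_norm _)).
  by rewrite /B' (bigD1 P) //= addrCA lerDl addr_ge0 // sumr_ge0.
apply: (leq_trans _ (subset_leq_card (A := f |: [set f | k f <= B]%SET) _)).
  rewrite cardsU1 inE; move: fP; rewrite inE ltNge => ->.
  by rewrite add1n ltnS Bk.
apply/fintype.subsetP => g; rewrite !inE => /predU1P[->//|gB].
exact: le_trans gB BB'.
Qed.

Lemma subsolution_bounded : exists B, forall k f, subsolution k -> k f <= B.
Proof.
have [B Bk] := subsolution_card_bounded (leqnn #|I|).
exists B => k f sk; have := Bk k sk.
rewrite leqNgt; have [//|kf] := leP (k f) B; case/negP.
rewrite -cardsT; apply: proper_card; apply/properP; split.
  exact: finset.subsetT.
by exists f; rewrite ?inE // -ltNge.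
Qed.

Definition update k f t : I -> R := fun g => if g == f then t else k g.

Lemma update_id k f : update k f (k f) = k.
Proof. by apply/funext => g; rewrite /update; case: eqP => [->|]. Qed.

Lemma continuous_face_curvature_update k f :
  continuous (fun t => face_curvature (update k f t) f).
Proof.
have cu g : continuous (fun t => update k f t g).
  rewrite /update; case: (g == f) => t; [exact: cvg_id|exact: cvg_cst].
move=> t; apply: cvg_sum => e _; apply: cvgD; case: (_ == _).
- exact: continuous_side_curvature.
- exact: cvg_cst.
- exact: continuous_side_curvature.
- exact: cvg_cst.
Qed.

Lemma face_curvature_onto :
  exists k, (forall f, 0 <= k f) /\ (forall f, face_curvature k f = L f).
Proof.
have [B kB] := subsolution_bounded.
pose values f := [set k f | k in subsolution].
have values_sup f : has_sup (values f).
  split; first by exists 0, (fun=> 0) => //; exact: subsolution0.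
  by exists B => _ [k sk <-]; exact: kB.
pose ks f := sup (values f).
have ks_ub k f : subsolution k -> k f <= ks f.
  by move=> sk; apply: sup_upper_bound (values_sup f) _ _; exists k.
have ks0 f : 0 <= ks f by exact: ks_ub subsolution0.
(* Only the f-coordinate has to be approximated: raising the others to their
   suprema lowers the curvature of f further. *)
have ks_sub f : face_curvature ks f <= L f.
  rewrite leNgt; apply/negP => Lks.
  have := @continuous_face_curvature_update ks f (ks f).
  rewrite /continuous_at update_id => /cvgr_gt/(_ _ Lks)/nbhs_ballP[d /= d0 dL].
  have [_ [k sk <-] kd] := sup_adherent d0 (values_sup f).
  have := dL (k f); rewrite -ball_normE /= => Lk.
  suff : L f < L f by rewrite ltxx.
  have kf := ks_ub k f sk.
  have := Lk; rewrite ger0_norm ?subr_ge0 // => /(_ _)/lt_le_trans; apply.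
    by rewrite ltrBlDl -ltrBlDr.
  have [k0 kL] := sk; apply: le_trans (kL f).
  apply: face_curvature_anti => //; first by rewrite /update eqxx.
  by move=> g; rewrite /update; case: eqP => [->//|_]; exact: ks_ub.
exists ks; split=> // f; apply/eqP; rewrite eq_le ks_sub leNgt /=; apply/negP => ksL.
have := @continuous_face_curvature_update ks f (ks f).
rewrite /continuous_at update_id => /cvgr_lt/(_ _ ksL)/nbhs_ballP[d /= d0 dL].
pose t := ks f + d / 2.
have kst : ks f < t by rewrite ltrDl divr_gt0.
have ft : face_curvature (update ks f t) f < L f.
  apply: dL; rewrite -ball_normE /= /t opprD addrA subrr sub0r normrN.
  by rewrite gtr0_norm ?divr_gt0 //; lra.
have le_update g : ks g <= update ks f t g.
  by rewrite /update; case: eqP => [->|//]; exact: ltW.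
have : update ks f t f <= ks f.
  apply: ks_ub; split=> g; first exact: le_trans (le_update g).
  have [->|gf] := eqVneq g f; first exact: ltW.
  apply: le_trans (ks_sub g).
  by apply: face_curvature_anti => //; rewrite /update (negbTE gf).
by rewrite /update eqxx leNgt kst.
Qed.

End Existence.
End Network.

(** * From the decomposition to the system *)

Section Decomposition.
Variables (R : realType) (S : topologicalType) (V E : finType) (n : nat).
Variable Sigma : cellular_decomposition R S V E n.
Variable Phi : E -> R.
Hypothesis Phi_itv : forall e, 0 < Phi e < pi / 2.

Local Notation incident := (incident (side1 Sigma) (side2 Sigma)).

Lemma in_faces_edges (P : {set 'I_n}) e :
  (e \in faces_edges Sigma P) = incident P e.
Proof.
apply/finset.bigcupP/idP => [[f fP]|].
  rewrite in_face_edges /incident.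
  by case/orP => /eqP ->; rewrite fP ?orbT.
by case/orP => eP; [exists (side1 Sigma e)|exists (side2 Sigma e)] => //;
  rewrite in_face_edges eqxx ?orbT.
Qed.

Lemma face_has_side f : exists e, (side1 Sigma e == f) || (side2 Sigma e == f).
Proof.
have [e ef] := face_has_edge Sigma f; exists e.
by rewrite -in_face_edges inE; apply/asboolP.
Qed.

Lemma total_curvatureE (k : 'cV[R]_n) f : conical_metric k ->
  total_curvature Sigma Phi k f 0 =
  face_curvature (side1 Sigma) (side2 Sigma) Phi (fun g => k g 0) f.
Proof.
move=> k0; rewrite mxE big_mkcond; apply: eq_bigr => e _.
have Phi_pi : 0 < Phi e < pi.
  by have := Phi_itv e; have := pi_gt0 R; lra.
rewrite in_face_edges /edge_curvature; case: eqP => [->|_];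
  case: eqP => [->|_] //=; rewrite ?side_lengthM ?addr0 //.
Qed.

(** The strata of the set of admissible curvatures are indexed by the support of
    L, and on each of them the inequalities bear on subsets of the support. *)
Lemma calLP (L : 'cV[R]_n) : calL Sigma Phi L <->
  (forall f, 0 <= L f 0) /\
  (forall P : {set 'I_n}, P != finset.set0 -> (forall f, f \in P -> 0 < L f 0) ->
     subset_bound Sigma Phi L P).
Proof.
split=> [[[L0 LP]|[[I _ [Lin Lout LP]]|->]]|[L0 LP]].
- by split=> [f|P P0 _]; [exact: ltW|exact: LP].
- split=> [f|P P0 PL].
    by have [/Lin/ltW|/Lout->] := boolP (f \in I).
  apply: LP => //; apply/fintype.subsetP => f /PL.
  by apply: contraTT => /Lout ->; rewrite ltxx.
- split=> [f|P /set0Pn[f fP] /(_ f fP)]; by rewrite mxE ?ltxx.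
pose I := [set f | 0 < L f 0]%SET.
have LI f : f \notin I -> L f 0 = 0.
  by rewrite inE -leNgt => Lf; apply/eqP; rewrite eq_le Lf L0.
have [IT|IT] := eqVneq I [set: 'I_n]%SET.
  left; have Lpos f : 0 < L f 0.
    by have /[!inE] : f \in I by rewrite IT inE.
  by split=> // P P0; apply: LP.
right; have [I0|I0] := eqVneq I finset.set0.
  by right; apply/colP => f; rewrite mxE LI // I0 inE.
left; exists I => /=.
  rewrite card_gt0 I0 /= -ltnS prednK; last first.
    have /set0Pn[f _] := I0; exact: leq_ltn_trans (ltn_ord f).
  rewrite -[ltnRHS](card_ord n) -cardsT.
  by apply: proper_card; rewrite finset.properEneq IT finset.subsetT.
split=> // [f|P P0 /fintype.subsetP PI]; first by rewrite inE.
by apply: LP => // f /PI; rewrite inE.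
Qed.

End Decomposition.

Theorem theorem1p8 (R : realType) (S : topologicalType)
    (hS : closed_surface R S) (V E : finType) (n : nat)
    (Sigma : cellular_decomposition R S V E n)
    (Phi : E -> R) (hPhi : forall e, 0 < Phi e < pi / 2)
    (Lhat : 'cV[R]_n) :
  ((exists k : 'cV[R]_n,
      conical_metric k /\ total_curvature Sigma Phi k = Lhat)
   <-> calL Sigma Phi Lhat) /\
  (forall k k' : 'cV[R]_n,
      conical_metric k -> total_curvature Sigma Phi k = Lhat ->
      conical_metric k' -> total_curvature Sigma Phi k' = Lhat ->
      k = k').
Proof.
have side := @face_has_side R S V E n Sigma.
split; last first.
  move=> k k' k0 kL k'0 k'L; apply/colP => f.
  apply: (@face_curvature_inj _ _ _ _ _ _ hPhi side (fun f => k f 0)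
    (fun f => k' f 0)) => // g.
  by rewrite -!total_curvatureE // kL k'L.
have faces_sum (P : {set 'I_n}) : \sum_(e in faces_edges Sigma P) Phi e =
    \sum_(e | incident (side1 Sigma) (side2 Sigma) P e) Phi e.
  by apply: eq_bigl => e; rewrite in_faces_edges.
split=> [[k [k0 <-]]|/calLP[L0 LP]].
  apply/calLP; split=> [f|P P0 _].
    by rewrite total_curvatureE //; exact: face_curvature_ge0.
  rewrite /subset_bound faces_sum.
  under eq_bigr => f _ do rewrite total_curvatureE //.
  exact: sum_face_curvature_lt.
have LP' (P : {set 'I_n}) : P != finset.set0 -> (forall f, f \in P -> 0 < Lhat f 0) ->
    \sum_(f in P) Lhat f 0 <
    2 * \sum_(e | incident (side1 Sigma) (side2 Sigma) P e) Phi e.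
  by move=> P0 PL; rewrite -faces_sum; apply: LP.
have [k [k0 kL]] := face_curvature_onto hPhi side L0 LP'.
exists (\col_f k f); have k0' : conical_metric (\col_f k f).
  by move=> f; rewrite mxE.
split=> //; apply/colP => f; rewrite total_curvatureE // -kL.
by congr face_curvature; apply/funext => g; rewrite mxE.
Qed.
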